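(* Let $m\ge2$ facilities all have capacity $k$, with $mk<n$. Let $\vec v\in[0,1]^m$ with $v_1<v_2<\dots<v_m$, and assume $\lfloor v_{j+1}(n-1)\rfloor-\lfloor v_j(n-1)\rfloor>1$ for every $j\in\{1,\dots,m-1\}$. Then $\mathcal{PM}_{\vec v}$ is Equilibrium Stable if and only if $\lfloor v_{j+1}(n-1)\rfloor-\lfloor v_j(n-1)\rfloor\ge 2k-1$ for every $j\in\{1,\dots,m-1\}$.
   Context: There are $n$ agents with positions $\vec x\in[0,1]^n$ and $m$ facilities; a location $\vec y=(y_1,\dots,y_m)$ places facility $j$ at $y_j$. A fixed priority order breaks ties. FCFS game induced by $(\vec x,\vec y)$ with capacities $k_1,\dots,k_m$ (here all equal to $k$): each agent $i$ chooses $s_i\in\{1,\dots,m\}$; $\mathcal S_j$ = agents choosing $j$; $T_j\subseteq\mathcal S_j$ = the $\min(k_j,|\mathcal S_j|)$ agents of $\mathcal S_j$ closest to $y_j$ (ties by priority); utility $u_i=1-|x_i-y_j|$ if $i\in T_j$, else $0$. $NE(\vec x,\vec y)$ = set of pure Nash equilibria; $SW_\gamma=\sum_iu_i$. A mechanism $M:[0,1]^n\to\mathbb R^m$ is absolutely truthful if for every $i,\vec x,x_i'\in[0,1],\vec s_{-i}$: $\max_{s_i}u_i(\vec x,M(\vec x);s_i,\vec s_{-i})\ge\max_{s_i'}u_i(\vec x,M(x_i',\vec x_{-i});s_i',\vec s_{-i})$; it is Equilibrium Stable (ES) if it is absolutely truthful and for every $\vec x$ all $\gamma\in NE(\vec x,M(\vec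 x))$ give the same $SW_\gamma(\vec x,M(\vec x))$. Percentile mechanism $\mathcal{PM}_{\vec v}$: sort reports $x_1\le\dots\le x_n$, set $y_j=x_{\lfloor(n-1)v_j\rfloor+1}$. *)

(* Defs.v *)
From HB Require Import structures.
From mathcomp Require Import all_boot all_order all_algebra all_fingroup.
From mathcomp Require Import reals.
Set Implicit Arguments. Unset Strict Implicit. Unset Printing Implicit Defensive.
Import Order.TTheory GRing.Theory Num.Theory.
Local Open Scope ring_scope.

Section FCFS.
Variables (R : realType) (n m k : nat) (prio : {perm 'I_n}).
(* prio: fixed priority order; agent i' has priority over i iff prio i' < prio i *)

Definition upd (T : Type) (f : 'I_n -> T) (i : 'I_n) (a : T) : 'I_n -> T :=
  fun i' => if i' == i then a else f i'.

Definition beats (x : 'I_n -> R) (yj : R) (i' i : 'I_n) : bool :=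
  (`|x i' - yj| < `|x i - yj|) ||
  ((`|x i' - yj| == `|x i - yj|) && (prio i' < prio i)%N).

(* i is in T_{s_i}: fewer than k agents choosing the same facility precede it,
   i.e. i is among the min(k,|S_j|) closest agents of S_j (ties by priority) *)
Definition served (x : 'I_n -> R) (y : 'I_m -> R) (s : 'I_n -> 'I_m) (i : 'I_n)
  : bool :=
  (#|[pred i' | (s i' == s i) && beats x (y (s i)) i' i]| < k)%N.

Definition util (x : 'I_n -> R) (y : 'I_m -> R) (s : 'I_n -> 'I_m) (i : 'I_n)
  : R := if served x y s i then 1 - `|x i - y (s i)| else 0.

Definition isNE (x : 'I_n -> R) (y : 'I_m -> R) (s : 'I_n -> 'I_m) : Prop :=
  forall (i : 'I_n) (a : 'I_m), util x y (upd s i a) i <= util x y s i.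

Definition SW (x : 'I_n -> R) (y : 'I_m -> R) (s : 'I_n -> 'I_m) : R :=
  \sum_(i < n) util x y s i.

Definition in01 (x : 'I_n -> R) : Prop := forall i, 0 <= x i <= 1.

(* absolute truthfulness: for every misreport and every s_{-i}, the best
   response utility under truthful reporting is at least the best response
   utility under the misreport (both games use the true positions x). *)
Definition abs_truthful (M : ('I_n -> R) -> ('I_m -> R)) : Prop :=
  forall (i : 'I_n) (x : 'I_n -> R) (xi' : R), in01 x -> 0 <= xi' <= 1 ->
  forall (s : 'I_n -> 'I_m) (a' : 'I_m), exists a : 'I_m,
    util x (M (upd x i xi')) (upd s i a') i <= util x (M x) (upd s i a) i.

Definition equilibrium_stable (M : ('I_n -> R) -> ('I_m -> R)) : Prop :=
  abs_truthful M /\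
  forall x : 'I_n -> R, in01 x ->
  forall s1 s2 : 'I_n -> 'I_m, isNE x (M x) s1 -> isNE x (M x) s2 ->
    SW x (M x) s1 = SW x (M x) s2.

End FCFS.

(* Percentile mechanism: y_j = x_{(floor((n-1) v_j) + 1)} (1-indexed order
   statistic), i.e. the entry at 0-based position floor((n-1) v_j) of the
   sorted reports. *)
Definition PM (R : realType) (n m : nat) (v : 'I_m -> R) (x : 'I_n -> R)
  : 'I_m -> R :=
  fun j => nth 0 (sort (fun a b : R => a <= b) [seq x i | i <- enum 'I_n])
                 (Num.truncn ((n - 1)%N%:R * v j)).

(* Main.v *)
Require Import Defs.
From HB Require Import structures.
From mathcomp Require Import all_boot all_order all_algebra all_fingroup.
From mathcomp Require Import reals.
From mathcomp Require Import zify lra.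
Set Implicit Arguments. Unset Strict Implicit. Unset Printing Implicit Defensive.
Import Order.TTheory GRing.Theory Num.Theory.
Local Open Scope ring_scope.

(** Truthfulness holds for every percentile vector: a misreport can only push
    each facility further from the misreporting agent, on the side where it
    already is, so the set of agents beating her there only grows.

    Write p_j for the 0-based rank floor((n-1) v_j).  If consecutive ranks
    differ by at least 2k-1, the interval between two facilities contains at
    least as many agents as the facilities in it have seats.  A counting
    argument then shows that in any equilibrium every facility fills its seats
    as if it were alone, so the distances served are the k smallest ones and the
    welfare is the same in all equilibria.

    If p_(j+1) - p_j <= 2k-2, put facilities j and j+1 at two points A < B, a
    single agent M at their midpoint, and fewer agents at A (resp. B) than there
    are seats.  M may go to A or to B; switching it moves exactly one outer agent
    from the nearer to the farther of A and B, which changes the welfare. *)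

(** * Counting the first k elements of a strict total order *)

Lemma card_top_rank (T : finType) (lt : rel T) (A : {pred T}) (k : nat) :
  irreflexive lt -> transitive lt ->
  (forall a b, a != b -> lt a b || lt b a) ->
  #|[pred a in A | (#|[pred b in A | lt b a]| < k)%N]| = minn k #|A|.
Proof.
move=> lt_irr lt_tr lt_tot.
pose rk a := #|[pred b in A | lt b a]|.
have rk_mono a b : a \in A -> lt a b -> (rk a < rk b)%N.
  move=> aA ab; apply: proper_card; apply/properP; split.
    by apply/subsetP=> c; rewrite !inE => /andP[-> ca]; apply: lt_tr ab.
  by exists a; rewrite !inE ?aA ?ab // lt_irr andbF.
have rk_inj : {in A &, injective rk}.
  move=> a b aA bA eq_rk; apply/eqP/negPn/negP => /lt_tot /orP[] ltab.
    by have := rk_mono _ _ aA ltab; rewrite eq_rk ltnn.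
  by have := rk_mono _ _ bA ltab; rewrite eq_rk ltnn.
have rk_lt a : a \in A -> (rk a < #|A|)%N.
  move=> aA; apply: proper_card; apply/properP; split.
    by apply/subsetP=> b; rewrite !inE => /andP[].
  by exists a; rewrite // inE lt_irr andbF.
have uniq_rk : uniq (map rk (enum A)).
  by rewrite map_inj_in_uniq ?enum_uniq // => a b; rewrite !mem_enum; apply: rk_inj.
(* The ranks are distinct and below [#|A|], so they are exactly 0, ..., [#|A|] - 1. *)
have perm_rk : perm_eq (map rk (enum A)) (iota 0 #|A|).
  have sub : {subset map rk (enum A) <= iota 0 #|A|}.
    by move=> r /mapP[a]; rewrite mem_enum => /rk_lt lta ->; rewrite mem_iota.
  have [|_ eq_mem] := uniq_min_size uniq_rk sub.
    by rewrite size_iota size_map -cardE.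
  by rewrite uniq_perm ?iota_uniq.
have -> : #|[pred a in A | (rk a < k)%N]| = count (gtn k) (map rk (enum A)).
  rewrite count_map -size_filter cardE /enum_mem -filter_predI; congr size.
  by apply: eq_filter => a; rewrite /= !inE andbC.
rewrite (seq.permP perm_rk); elim: #|A| => [|p IH]; first by rewrite minn0.
by rewrite -{1}addn1 iotaD count_cat IH /= add0n addn0; case: ltnP; lia.
Qed.

(** Whatever precedes an element of the down-closed [P] is in [P], so her rank within [A] is also
    her rank within the part of [A] in [P]. *)
Lemma card_top_rank_downset (T : finType) (lt : rel T) (A P : {pred T})
    (k : nat) :
  irreflexive lt -> transitive lt ->
  (forall a b, a != b -> lt a b || lt b a) ->
  (forall a b, b \in P -> lt a b -> a \in P) ->
  #|[pred a in A | (a \in P) && (#|[pred b in A | lt b a]| < k)%N]| =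
  minn k #|[pred a in A | a \in P]|.
Proof.
move=> lt_irr lt_tr lt_tot downP.
rewrite -(@card_top_rank _ lt) //; apply: eq_card => a; rewrite !inE.
case: (a \in A) => //=; have [aP|//] := boolP (a \in P); congr (_ < _)%N => /=.
apply: eq_card => b; rewrite !inE; case: (b \in A) => //=.
by have [/(downP _ _ aP) ->|] := boolP (lt b a); rewrite ?andbF.
Qed.

(** * Service and best replies in the FCFS game *)

Section Game.
Variables (R : realType) (n m k : nat) (prio : {perm 'I_n}).
Implicit Types (x : 'I_n -> R) (y : 'I_m -> R) (s : 'I_n -> 'I_m).

Lemma beats_irr x c : irreflexive (beats prio x c).
Proof. by move=> i; rewrite /beats ltxx eqxx ltnn. Qed.

Lemma beats_trans x c : transitive (beats prio x c).
Proof.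
move=> b a d; rewrite /beats => /orP[ab|/andP[/eqP-> ab]] /orP[bd|/andP[/eqP<- bd]].
- by rewrite (lt_trans ab bd).
- by rewrite ab.
- by rewrite bd.
- by rewrite eqxx (ltn_trans ab bd) orbT.
Qed.

Lemma beats_total x c i j : i != j -> beats prio x c i j || beats prio x c j i.
Proof.
move=> ne; rewrite /beats; case: ltgtP => //= _.
by rewrite -neq_ltn; apply: contra ne => /eqP/val_inj/perm_inj->.
Qed.

Lemma beats_dist x c i j : beats prio x c i j -> `|x i - c| <= `|x j - c|.
Proof. by case/orP=> [/ltW//|/andP[/eqP-> _]]. Qed.

Lemma upd_same (T : Type) (f : 'I_n -> T) i a : upd f i a i = a.
Proof. by rewrite /upd eqxx. Qed.

Lemma upd_neq (T : Type) (f : 'I_n -> T) i a i' : i' != i -> upd f i a i' = f i'.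
Proof. by rewrite /upd => /negPf->. Qed.

Lemma served_upd x y s i f :
  served k prio x y (upd s i f) i =
  (#|[pred i' | (s i' == f) && beats prio x (y f) i' i]| < k)%N.
Proof.
rewrite /served upd_same; congr (_ < _)%N; apply: eq_card => i'; rewrite !inE.
by have [->|ne] := eqVneq i' i; [rewrite beats_irr !andbF | rewrite upd_neq].
Qed.

(** At distance below 1 a seat at [f] has positive value, so an agent who could get one must already
    be served, and no farther away. *)
Lemma isNE_best_reply x y s i f :
  isNE k prio x y s -> `|x i - y f| < 1 ->
  (#|[pred i' | (s i' == f) && beats prio x (y f) i' i]| < k)%N ->
  served k prio x y s i /\ `|x i - y (s i)| <= `|x i - y f|.
Proof.
move=> /(_ i f) ne d1; rewrite -(served_upd x y s i f) => sv.
move: ne; rewrite /util sv upd_same; case: ifP => // _; lra.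
Qed.

Lemma card_served x y s f :
  (#|[pred i | (s i == f) && served k prio x y s i]| <= k)%N.
Proof.
apply: leq_trans (geq_minl k #|[pred i | s i == f]|).
rewrite -(@card_top_rank _ (beats prio x (y f))); last first.
- exact: beats_total.
- exact: beats_trans.
- exact: beats_irr.
apply: subset_leq_card; apply/subsetP => i; rewrite !inE => /andP[/eqP si].
by rewrite /served si eqxx.
Qed.

End Game.

(** * Crowded locations have a unique equilibrium welfare *)

Section UniqueWelfare.
Variables (R : realType) (n m k : nat) (prio : {perm 'I_n}).
Implicit Types (x : 'I_n -> R) (y : 'I_m -> R) (s : 'I_n -> 'I_m).

(** The condition [j != c] spares a single facility, whose point may hold fewer than k agents;
    distinct facilities at one point are still covered. *)
Definition crowded x y :=
  forall j c : 'I_m, j != c -> y j <= y c ->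
    (#|[pred f | (y j <= y f <= y c)%R]| * k <=
     #|[pred i | (y j <= x i <= y c)%R]|)%N.

(** By contradiction: otherwise every agent as near to [j] as [i] could get a seat at [j], hence is
    already served at least as near. Some interval starting at [y j] then has all its agents served
    by its own facilities while [j] keeps a seat free, against [crowded]. *)
Lemma isNE_fills_right x y s i j :
  crowded x y -> isNE k prio x y s -> s i != j -> y j <= x i ->
  x i - y j < 1 ->
  (k <= #|[pred l | (s l == j) && (`|x l - y j| <= `|x i - y j|)%R]|)%N.
Proof.
move=> cr ne sij yx xy1; rewrite leqNgt; apply/negP => ltk.
have di : `|x i - y j| = x i - y j by rewrite ger0_norm ?subr_ge0.
rewrite di in ltk.
have near_j l : `|x l - y j| <= x i - y j ->
    served k prio x y s l /\ `|x l - y (s l)| <= `|x l - y j|.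
  move=> dl; apply: isNE_best_reply => //; first exact: le_lt_trans dl _.
  apply: leq_ltn_trans ltk; apply: subset_leq_card; apply/subsetP => l'.
  rewrite !inE => /andP[-> /beats_dist dl'] /=; exact: le_trans dl' dl.
(* Among the agents in [y j, x i] not choosing [j], [c] has the rightmost facility; all agents in [y j, y (s c)] are then served inside that interval. *)
pose Q := [pred l | (y j <= x l <= x i) && (s l != j)].
have Qi : Q i by rewrite /= yx lexx.
have [c Qc max_c] := @arg_maxP _ R 'I_n i Q (fun l => y (s l)) Qi.
move: Qc => /= /andP[/andP[yxc xci] sc].
have [|svc dc] := near_j c; first by rewrite ger0_norm ?subr_ge0 // lerB.
rewrite [`|x c - y j|]ger0_norm ?subr_ge0 // in dc.
have ycc : y j <= y (s c) by move: dc; rewrite ler_norml; lra.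
(* Here [l] is strictly nearer to [s c] than [c], who is served there, so [l] would be served there
   too. *)
have near_c l : x c < x l -> x l <= y (s c) ->
    served k prio x y s l /\ `|x l - y (s l)| <= `|x l - y (s c)|.
  move=> ltl lel.
  have ltd : `|x l - y (s c)| < `|x c - y (s c)|.
    by rewrite !ler0_norm ?subr_le0 //; lra.
  apply: isNE_best_reply => //; first by lra.
  apply: leq_ltn_trans svc; apply: subset_leq_card; apply/subsetP => l'.
  rewrite !inE => /andP[-> bl'] /=; apply: beats_trans bl' _.
  by rewrite /beats ltd.
pose I := [pred l | y j <= x l <= y (s c)].
pose F := [pred f | y j <= y f <= y (s c)].
have stay l : I l -> [/\ served k prio x y s l, F (s l) &
    s l = j -> `|x l - y j| <= x i - y j].
  move=> /= /andP[yl lyc]; have [lec|gtc] := leP (x l) (x c).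
    have dlj : `|x l - y j| <= x i - y j.
      by rewrite ger0_norm ?subr_ge0 // lerB // (le_trans lec).
    have [svl dl] := near_j l dlj; split=> //.
    rewrite [`|x l - y j|]ger0_norm ?subr_ge0 // in dl.
    apply/andP; split; first by move: dl; rewrite ler_norml; lra.
    have [->//|slj] := eqVneq (s l) j.
    by apply: max_c; rewrite /= yl slj (le_trans lec).
  have [svl dl] := near_c l gtc lyc.
  rewrite [`|x l - y (s c)|]ler0_norm ?subr_le0 // in dl.
  (* Indeed y (s l) >= 2 x l - y (s c) > 2 x c - y (s c) >= y j. *)
  have ltj : y j < y (s l).
    by move: dl dc; rewrite !ler_norml; lra.
  split=> //; last by move=> slj; rewrite slj ltxx in ltj.
  by move: dl; rewrite ler_norml (ltW ltj) /=; lra.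
suff : (#|I| < #|F| * k)%N by rewrite ltnNge cr // eq_sym.
have Fj : F j by rewrite /= lexx ycc.
pose G f := [pred l | I l && (s l == f)].
have -> : #|I| = (\sum_(f | F f) #|G f|)%N.
  rewrite -sum1_card (partition_big s F) /=; last by move=> l /stay[].
  by apply: eq_bigr => f _; rewrite sum1_card.
have -> : (#|F| * k)%N = (\sum_(f | F f) k)%N by rewrite sum_nat_const.
rewrite (bigD1 j) // [X in (_ < X)%N](bigD1 j) //= -addSn leq_add //.
  apply: leq_ltn_trans ltk; apply: subset_leq_card; apply/subsetP => l.
  by rewrite !inE => /andP[/stay[_ _ sl] /eqP slj]; rewrite slj eqxx sl.
apply: leq_sum => f _; apply: leq_trans (card_served k prio x y s f).
apply: subset_leq_card; apply/subsetP => l.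
by rewrite !inE => /andP[/stay[-> _ _] ->].
Qed.

Let neg (T : Type) (z : T -> R) t := - z t.

Lemma dist_neg x y i j : `|neg x i - neg y j| = `|x i - y j|.
Proof. by rewrite /neg -opprD normrN. Qed.

Lemma util_neg x y s i :
  util k prio (neg x) (neg y) s i = util k prio x y s i.
Proof.
rewrite /util dist_neg /served; congr (if (_ < _)%N then _ else _).
by apply: eq_card => l; rewrite !inE /beats !dist_neg.
Qed.

(** Negating all positions preserves distances, equilibria and crowding, and turns the left side
    into the right one. *)
Lemma isNE_fills x y s i j :
  crowded x y -> isNE k prio x y s -> s i != j -> `|x i - y j| < 1 ->
  (k <= #|[pred l | (s l == j) && (`|x l - y j| <= `|x i - y j|)%R]|)%N.
Proof.
move=> cr ne sij; have [yx|xy] := leP (y j) (x i).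
  by rewrite {1}ger0_norm ?subr_ge0 //; apply: isNE_fills_right.
rewrite ler0_norm ?subr_le0 ?(ltW xy) // => d1.
have -> : #|[pred l | (s l == j) && (`|x l - y j| <= - (x i - y j))]| =
  #|[pred l | (s l == j) && (`|neg x l - neg y j| <= `|neg x i - neg y j|)]|.
  apply: eq_card => l; rewrite !inE !dist_neg.
  by rewrite [`|x i - y j|]ler0_norm ?subr_le0 ?(ltW xy).
apply: isNE_fills_right => //; rewrite /neg; try lra.
- move=> j' c jc yjc; have := cr c j'.
  rewrite eq_sym jc (_ : y c <= y j') => [/(_ isT isT)|]; last by lra.
  congr (_ * _ <= _)%N; apply: eq_card => t; rewrite !inE; lra.
- by move=> i' a; rewrite !util_neg.
Qed.

(** Either all agents with distance in [P] choose [j], or one of them does not and [isNE_fills]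
    gives k nearer or equally near choosers, so both sides are k. The right side does not depend on
    [s]. *)
Lemma card_served_downset x y s j (P : {pred R}) :
  crowded x y -> isNE k prio x y s ->
  (forall a b, b \in P -> a <= b -> a \in P) ->
  (forall a, a \in P -> a < 1) ->
  #|[pred l | [&& s l == j, served k prio x y s l & `|x l - y j| \in P]]| =
  minn k #|[pred l | `|x l - y j| \in P]|.
Proof.
move=> cr ne downP P1.
have -> : #|[pred l | [&& s l == j, served k prio x y s l & `|x l - y j| \in P]]|
  = minn k #|[pred l | (s l == j) && (`|x l - y j| \in P)]|.
  rewrite -(@card_top_rank_downset _ (beats prio x (y j)) [pred l | s l == j]
      [pred l | `|x l - y j| \in P]).
  - apply: eq_card => l; rewrite !inE; case: eqVneq => //= sl.
    by rewrite andbC /served sl.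
  - exact: beats_irr.
  - exact: beats_trans.
  - exact: beats_total.
  - by move=> a b; rewrite !inE => bP /beats_dist; apply: downP.
set S := [pred l | _ && _]; set N := [pred l | _].
have leSN : (#|S| <= #|N|)%N.
  by apply: subset_leq_card; apply/subsetP => l; rewrite !inE => /andP[].
have [leNS|/subsetPn[i]] := boolP (N \subset S).
  by congr minn; apply/eqP; rewrite eqn_leq leSN subset_leq_card.
rewrite !inE => iP; rewrite iP andbT => sij.
suff leS : (k <= #|S|)%N by rewrite !(minn_idPl _) // (leq_trans leS).
apply: leq_trans (isNE_fills cr ne sij (P1 _ iP)) _.
apply: subset_leq_card; apply/subsetP => l; rewrite !inE => /andP[-> /=].
exact: downP.
Qed.

(** The number served at distance exactly [w] is the number within [w] minus the number strictly
    within [w]; both are the same in all equilibria. *)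
Lemma card_served_dist x y s1 s2 j w :
  crowded x y -> isNE k prio x y s1 -> isNE k prio x y s2 -> w < 1 ->
  #|[pred l | [&& s1 l == j, served k prio x y s1 l & `|x l - y j| == w]]| =
  #|[pred l | [&& s2 l == j, served k prio x y s2 l & `|x l - y j| == w]]|.
Proof.
move=> cr ne1 ne2 w1.
have count_w s : isNE k prio x y s ->
    (#|[pred l | [&& s l == j, served k prio x y s l & (`|x l - y j| == w)%R]]| +
     minn k #|[pred l | (`|x l - y j| < w)%R]| =
     minn k #|[pred l | (`|x l - y j| <= w)%R]|)%N.
  move=> ne.
  rewrite -(@card_served_downset x y s j [pred a | a <= w]) //; last 2 first.
  - by move=> a b; rewrite !inE => bw /le_trans; apply.
  - by move=> a; rewrite !inE => /le_lt_trans; apply.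
  rewrite -(@card_served_downset x y s j [pred a | a < w]) //; last 2 first.
  - by move=> a b; rewrite !inE => bw /le_lt_trans; apply.
  - by move=> a; rewrite !inE => /lt_trans; apply.
  rewrite -[RHS](cardID [pred l | `|x l - y j| == w]); congr (_ + _)%N.
    apply: eq_card => l; rewrite !inE.
    by case: (eqVneq `|x l - y j| w) => [->|]; rewrite ?lexx ?andbT ?andbF.
  by apply: eq_card => l; rewrite !inE lt_neqAle; case: (eqVneq `|x l - y j| w);
    rewrite ?andbF.
by apply/eqP; rewrite -(eqn_add2r (minn k #|[pred l | (`|x l - y j| < w)%R]|)) !count_w.
Qed.

(** Agents at distance exactly 1 contribute 0; dropping them leaves the distances below 1 to which
    the counts apply. *)
Lemma SW_by_facility x y s :
  (forall i j, `|x i - y j| <= 1) ->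
  SW k prio x y s =
  \sum_(j < m) \sum_(l | [&& s l == j, served k prio x y s l & `|x l - y j| < 1])
     (1 - `|x l - y j|).
Proof.
move=> d1; rewrite /SW (partition_big s predT) //=; apply: eq_bigr => j _.
rewrite [RHS]big_mkcond [LHS]big_mkcond; apply: eq_bigr => l _ /=.
case: eqVneq => //= <-; rewrite /util; case: served => //=.
case: ltgtP (d1 l (s l)) => // -> _; exact: subrr.
Qed.

Lemma crowded_SW x y s1 s2 :
  (forall i j, `|x i - y j| <= 1) -> crowded x y ->
  isNE k prio x y s1 -> isNE k prio x y s2 ->
  SW k prio x y s1 = SW k prio x y s2.
Proof.
move=> d1 cr ne1 ne2; rewrite !SW_by_facility //; apply: eq_bigr => j _.
pose T s := [pred l | [&& s l == j, served k prio x y s l & `|x l - y j| < 1]].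
pose ds s := [seq `|x l - y j| | l <- enum (T s)].
have sumE s : \sum_(l | T s l) (1 - `|x l - y j|) = \sum_(w <- ds s) (1 - w).
  by rewrite big_map big_enum.
rewrite !(sumE s1, sumE s2); apply: perm_big; rewrite /perm_eq.
have count_ds s w : count_mem w (ds s) = if w < 1 then
   #|[pred l | [&& s l == j, served k prio x y s l & `|x l - y j| == w]]| else 0.
  rewrite count_map -size_filter /enum_mem -filter_predI; case: ifP => w1.
    rewrite cardE; congr size; apply: eq_filter => l; rewrite /= !inE.
    by case: (eqVneq `|x l - y j| w) => [->|]; rewrite ?w1 ?andbT ?andbF.
  rewrite (eq_filter (a2 := pred0)) ?filter_pred0 // => l; rewrite /= !inE.
  by case: (eqVneq `|x l - y j| w) => [->|]; rewrite ?w1 ?andbF.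
apply/allP => w _ /=; rewrite !count_ds; case: ifP => // w1.
by rewrite (card_served_dist j cr ne1 ne2 w1).
Qed.

End UniqueWelfare.

(** * The percentile mechanism: order statistics, truthfulness, crowding *)

Section Percentile.
Variables (R : realType) (n m : nat) (v : 'I_m -> R).
Implicit Types (x : 'I_n -> R) (j : 'I_m).

Definition percentile_rank j := Num.truncn ((n - 1)%N%:R * v j).

Hypothesis v01 : forall j, 0 <= v j <= 1.
Hypothesis n_gt0 : (0 < n)%N.

Lemma percentile_rank_lt j : (percentile_rank j < n)%N.
Proof.
have /andP[v0 v1] := v01 j.
have : (percentile_rank j <= n - 1)%N; last by lia.
rewrite /percentile_rank truncn_le_nat; apply: le_lt_trans (_ : (n - 1)%:R < _).
  by rewrite ler_piMr.
by rewrite ltr_nat.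
Qed.

Let sorted_reports x := sort (fun a b : R => a <= b) [seq x i | i <- enum 'I_n].

Lemma sorted_reportsP x : sorted <=%O (sorted_reports x).
Proof. exact/sort_sorted/le_total. Qed.

Lemma size_sorted_reports x : size (sorted_reports x) = n.
Proof. by rewrite size_sort size_map size_enum_ord. Qed.

Lemma count_sorted_reports x (P : pred R) :
  count P (sorted_reports x) = #|[pred i | P (x i)]|.
Proof.
rewrite (seq.permP (permEl (perm_sort _ _))) count_map cardE.
rewrite -size_filter /enum_mem -filter_predI; congr size.
by apply: eq_filter => i; rewrite /= !inE andbT.
Qed.

Lemma PM_ge x j t :
  (#|[pred i | (x i < t)%R]| <= percentile_rank j)%N -> t <= PM v x j.
Proof.
move=> c; apply: nth_count_ge; first exact: sorted_reportsP.
by rewrite (count_sorted_reports x (< t)) c size_sorted_reports percentile_rank_lt.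
Qed.

Lemma PM_le x j t :
  (percentile_rank j < #|[pred i | (x i <= t)%R]|)%N -> PM v x j <= t.
Proof.
move=> c; apply: nth_count_le; first exact: sorted_reportsP.
by rewrite (count_sorted_reports x (<= t)).
Qed.

Lemma card_lt_PM x j :
  (#|[pred i | (x i < PM v x j)%R]| <= percentile_rank j)%N.
Proof.
rewrite leqNgt -(count_sorted_reports x (< PM v x j)); apply/negP => c.
by have := nth_count_lt 0 (sorted_reportsP x) c; rewrite ltxx.
Qed.

Lemma card_le_PM x j :
  (percentile_rank j < #|[pred i | (x i <= PM v x j)%R]|)%N.
Proof.
rewrite ltnNge -(count_sorted_reports x (<= PM v x j)); apply/negP => c.
have := @nth_count_gt _ _ (PM v x j) 0 _ (percentile_rank j) (sorted_reportsP x).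
by rewrite c size_sorted_reports percentile_rank_lt ltxx => /(_ isT).
Qed.

Lemma PM_in01 x j : in01 x -> 0 <= PM v x j <= 1.
Proof.
move=> x01; have : PM v x j \in sorted_reports x.
  by rewrite mem_nth // size_sorted_reports percentile_rank_lt.
by rewrite mem_sort => /mapP[i _ ->].
Qed.

(** Agent [i] is already among the reports below the facility, so a new report cannot raise their
    number. On the other side she is not among the reports at or below it, so she cannot lower
    theirs. *)
Lemma PM_misreport_right x i t j :
  x i < PM v x j -> PM v x j <= PM v (upd x i t) j.
Proof.
move=> xy; apply: PM_ge; apply: leq_trans (card_lt_PM x j).
apply: subset_leq_card; apply/subsetP => l; rewrite !inE /upd.
by case: eqVneq => // ->.
Qed.

Lemma PM_misreport_left x i t j :
  PM v x j < x i -> PM v (upd x i t) j <= PM v x j.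
Proof.
move=> yx; apply: PM_le; apply: leq_trans (card_le_PM x j) _.
apply: subset_leq_card; apply/subsetP => l; rewrite !inE /upd.
by case: eqVneq => // ->; rewrite leNgt yx.
Qed.

(** The ball around [a] with [x i] on its boundary lies inside the one around [b], since they touch
    at [x i]. If [x i] = [a], the first ball is a point and [b] is arbitrary. *)
Lemma beats_moved_away (prio : {perm 'I_n}) x i (a b : R) :
  x i = a \/ (x i < a /\ a <= b) \/ (a < x i /\ b <= a) ->
  `|x i - a| <= `|x i - b| /\
  forall l, beats prio x a l i -> beats prio x b l i.
Proof.
move=> away.
have far c : `|c - a| <= `|x i - a| -> `|c - b| <= `|x i - b|.
  case: away => [->|[[xa ab]|[ax ba]]].
  - by rewrite subrr normr0 normr_le0 subr_eq0 => /eqP->.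
  - by rewrite [`|x i - a|]ltr0_norm ?[`|x i - b|]ltr0_norm ?ler_norml; lra.
  - by rewrite [`|x i - a|]gtr0_norm ?[`|x i - b|]gtr0_norm ?ler_norml; lra.
have far_lt c : `|c - a| < `|x i - a| -> `|c - b| < `|x i - b|.
  case: away => [->|[[xa ab]|[ax ba]]].
  - by rewrite subrr normr0 normr_lt0.
  - by rewrite [`|x i - a|]ltr0_norm ?[`|x i - b|]ltr0_norm ?ltr_norml; lra.
  - by rewrite [`|x i - a|]gtr0_norm ?[`|x i - b|]gtr0_norm ?ltr_norml; lra.
split=> [|l].
  case: away => [->|[[xa ab]|[ax ba]]]; first by rewrite subrr normr0.
    by rewrite !ltr0_norm; lra.
  by rewrite !gtr0_norm; lra.
rewrite /beats => /orP[/far_lt->//|/andP[/eqP eq ->]].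
by rewrite andbT orbC -le_eqVlt far // eq.
Qed.

Lemma PM_abs_truthful k (prio : {perm 'I_n}) :
  abs_truthful k prio (@PM R n m v).
Proof.
(* The facility chosen after the misreport is at least as good under the truth. *)
move=> i x t x01 t01 s a; exists a.
have [di bi] : `|x i - PM v x a| <= `|x i - PM v (upd x i t) a| /\
    forall l, beats prio x (PM v x a) l i -> beats prio x (PM v (upd x i t) a) l i.
  apply: beats_moved_away; case: (ltgtP (x i) (PM v x a)) => [lt|gt|]; last by left.
    by right; left; split=> //; apply: PM_misreport_right.
  by right; right; split=> //; apply: PM_misreport_left.
rewrite /util !upd_same !served_upd; case: ifP => sv; last first.
  case: ifP => // _; have := x01 i; have := PM_in01 a x01.
  rewrite subr_ge0 ler_norml; lra.
rewrite ifT; first by rewrite lerB.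
apply: leq_ltn_trans sv; apply: subset_leq_card; apply/subsetP => l.
by rewrite !inE => /andP[-> /bi].
Qed.

Lemma card_ord_interval a b : (#|[pred j : 'I_m | (a <= j <= b)%N]| <= b.+1 - a)%N.
Proof.
rewrite cardE -(size_map val) -(size_iota a (b.+1 - a)); apply: uniq_leq_size.
  by rewrite map_inj_uniq ?enum_uniq //; apply: val_inj.
move=> t /mapP[j]; rewrite mem_enum inE mem_iota => /andP[aj jb] -> /=; lia.
Qed.

Lemma card_PM_interval x j c :
  ((percentile_rank c).+1 - percentile_rank j <= 
   #|[pred i | (PM v x j <= x i <= PM v x c)%R]|)%N.
Proof.
rewrite leq_subLR; apply: leq_trans (card_le_PM x c) _.
rewrite -(cardID [pred i | (x i < PM v x j)%R]) leq_add //.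
  apply: leq_trans (card_lt_PM x j); apply: subset_leq_card.
  by apply/subsetP => l; rewrite !inE => /andP[].
by apply/subset_leq_card/subsetP => l; rewrite !inE -leNgt.
Qed.

Lemma percentile_rank_gap G :
  (forall j j' : 'I_m, val j' = (val j).+1 ->
     percentile_rank j + G <= percentile_rank j')%N ->
  forall j j' : 'I_m, (j <= j')%N ->
     (percentile_rank j + (j' - j) * G <= percentile_rank j')%N.
Proof.
move=> step j j' lejj'; move: {-2}(j' - j)%N (erefl (j' - j)%N) => d.
elim: d j' lejj' => [|d IH] j' lejj' dE.
  by rewrite mul0n addn0 (_ : j = j') //; apply: val_inj => /=; lia.
have lt_m : (j'.-1 < m)%N by apply: leq_ltn_trans (ltn_ord j'); lia.
have := IH (Ordinal lt_m); have := step (Ordinal lt_m) j'; rewrite /=; lia.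
Qed.

(** If the facilities in the interval have extreme indices a and b, with d = b - a >= 1, they number
    at most d + 1, while the interval holds at least d(2k-1) + 1 agents. The surplus d(2k-1) + 1 -
    (d+1)k = (d-1)(k-1) is nonnegative. *)
Lemma crowded_PM k x : (0 < k)%N ->
  (forall j j' : 'I_m, val j' = (val j).+1 ->
     percentile_rank j + (2 * k - 1) <= percentile_rank j')%N ->
  crowded k x (PM v x).
Proof.
move=> k_gt0 step j c jc yjc.
set F := [pred f | _]; have Fj : F j by rewrite /= lexx yjc.
have Fc : F c by rewrite /= lexx yjc.
case: (arg_minnP (fun f : 'I_m => nat_of_ord f) Fj) => a Fa min_a.
case: (arg_maxnP (fun f : 'I_m => nat_of_ord f) Fj) => b Fb max_b.
have cardF : (#|F| <= b.+1 - a)%N.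
  apply: leq_trans (card_ord_interval a b); apply: subset_leq_card.
  by apply/subsetP => f Ff; apply/andP; split; [apply: min_a | apply: max_b].
have lt_ab : (a < b)%N.
  have : (j : nat) != c by [].
  have := min_a _ Fj; have := max_b _ Fj; have := min_a _ Fc; have := max_b _ Fc.
  rewrite /=; lia.
have gap := percentile_rank_gap step (ltnW lt_ab).
have sub : (#|[pred i | (PM v x a <= x i <= PM v x b)%R]| <=
   #|[pred i | (PM v x j <= x i <= PM v x c)%R]|)%N.
  apply: subset_leq_card; apply/subsetP => l; rewrite !inE => /andP[al lb].
  move: Fa Fb => /= /andP[ja _] /andP[_ bc].
  by rewrite (le_trans ja al) (le_trans lb bc).
have := card_PM_interval x a b.
suff : (#|F| * k <= (percentile_rank b).+1 - percentile_rank a)%N by lia.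
apply: leq_trans (leq_mul cardF (leqnn k)) _.
have [d dE] : exists d, (b - a = d.+1)%N by exists (b - a).-1; lia.
rewrite dE in gap; rewrite subSn ?dE; nia.
Qed.

End Percentile.

(** * Equilibria from explicit seat assignments, and the zone assignment *)

Lemma assignment_isNE (R : realType) (n m k : nat) (prio : {perm 'I_n})
    (x : 'I_n -> R) (y : 'I_m -> R) (s : 'I_n -> 'I_m) (T : pred 'I_n)
    (hold : 'I_m -> 'I_k -> 'I_n) :
  (forall i f, `|x i - y f| <= 1) ->
  (forall f, injective (hold f)) ->
  (forall f t, T (hold f t) /\ s (hold f t) = f) ->
  (forall i, T i -> exists t, hold (s i) t = i) ->
  (forall i f, T i /\ `|x i - y (s i)| <= `|x i - y f| \/
     forall l, T l -> s l = f -> beats prio x (y f) l i) ->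
  isNE k prio x y s /\
  forall i, util k prio x y s i = if T i then 1 - `|x i - y (s i)| else 0.
Proof.
move=> d1 hold_inj holdT T_hold stab.
(* All k seats of [f] have distinct occupants [hold f t], so a newcomer beaten by all of them gets
   nothing. *)
have cardT f : #|[pred i | T i && (s i == f)]| = k.
  rewrite -[RHS]card_ord -(card_imset predT (hold_inj f)).
  apply: eq_card => i; rewrite !inE; apply/andP/imsetP => [[Ti /eqP<-]|[t _ ->]].
    by have [t ti] := T_hold i Ti; exists t.
  by have [-> ->] := holdT f t.
have beaten i f : (forall l, T l -> s l = f -> beats prio x (y f) l i) ->
    (k <= #|[pred l | (s l == f) && beats prio x (y f) l i]|)%N.
  move=> b; rewrite -(cardT f); apply/subset_leq_card/subsetP => l.
  by rewrite !inE => /andP[Tl /eqP sl]; rewrite sl eqxx b.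
have servedT i : served k prio x y s i = T i.
  case Ti: (T i); last first.
    apply/negbTE; rewrite -leqNgt; apply: beaten.
    by have [[]|] := stab i (s i); first by rewrite Ti.
  rewrite /served -(cardT (s i)); apply: proper_card; apply/properP; split.
    apply/subsetP => l; rewrite !inE => /andP[/eqP sl bl]; rewrite sl eqxx andbT.
    case: (stab l (s i)) => [[]//|/(_ i Ti erefl) /(beats_trans bl)].
    by rewrite beats_irr.
  by exists i; rewrite !inE ?Ti ?eqxx // beats_irr.
have utilT i : util k prio x y s i = if T i then 1 - `|x i - y (s i)| else 0.
  by rewrite /util servedT.
split=> // i f; rewrite utilT.
have [[Ti di]|/beaten b] := stab i f; rewrite /util served_upd upd_same.
  by rewrite Ti; case: ifP => _; rewrite ?lerB // subr_ge0.
by rewrite ltnNge b /=; case: ifP; rewrite // subr_ge0.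
Qed.

(* From left to right: far left, A, the midpoint M of A and B, B, far right.
   Agents may be in any zone, facilities in any zone but ZM. *)
Inductive zone := ZL | ZA | ZM | ZB | ZR.

(* Positions in tenths.  Far-right agents are closer to A than far-left ones, and
   every outer agent is farther from A and B than M is. *)
Definition place (z : zone) : nat :=
  match z with ZL => 0 | ZA => 5 | ZM => 6 | ZB => 7 | ZR => 9 end.

Definition zdist (z w : zone) : nat := (place z - place w) + (place w - place z).

(* [rk] is the rank of an element inside its zone and [elt z r] the element of
   rank [r] in zone [z]. *)
Definition labelling (T : Type) (cnt : zone -> nat) (cl : T -> zone)
    (rk : T -> nat) (elt : zone -> nat -> T) :=
  (forall z r, (r < cnt z)%N -> cl (elt z r) = z /\ rk (elt z r) = r) /\
  (forall i, (rk i < cnt (cl i))%N /\ elt (cl i) (rk i) = i).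

Section ZoneAssignment.
Variables (na cap : zone -> nat) (mu : bool).

(** [a0] and [b0] count the seats of A and B taken by their own agents and M, [sA] and [sB] the
    seats left, and [w] the far-right agents who find no seat in ZR or B. *)
Let a0 := (na ZA + mu)%N.
Let b0 := (na ZB + ~~ mu)%N.
Let sA := (cap ZA - a0)%N.
Let sB := (cap ZB - b0)%N.
Let w := (na ZR - cap ZR - sB)%N.

(* The equilibrium in which M goes to A if [mu] and to B otherwise: the seat, given
   as a zone and a rank among its [cap z] seats, of the agent of rank [r] in zone
   [z], or [None] if she is not served.  The far-right agents without a seat in
   ZR fill B and then A; the far-left ones fill what remains of A.
   [holder] is the inverse map. *)
Definition slot (z : zone) (r : nat) : option (zone * nat) :=
  match z with
  | ZL => if (r < cap ZL)%N then Some (ZL, r)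
          else if (w + (r - cap ZL) < sA)%N
          then Some (ZA, (a0 + w + (r - cap ZL))%N) else None
  | ZA => Some (ZA, r)
  | ZM => if mu then Some (ZA, na ZA) else Some (ZB, na ZB)
  | ZB => Some (ZB, r)
  | ZR => if (r < cap ZR)%N then Some (ZR, r)
          else if (r - cap ZR < sB)%N then Some (ZB, (b0 + (r - cap ZR))%N)
          else if (r - cap ZR - sB < sA)%N
          then Some (ZA, (a0 + (r - cap ZR - sB))%N) else None
  end.

Definition holder (z : zone) (t : nat) : zone * nat :=
  match z with
  | ZA => if (t < na ZA)%N then (ZA, t) else if (t < a0)%N then (ZM, 0%N)
          else if (t - a0 < w)%N then (ZR, (cap ZR + sB + (t - a0))%N)
          else (ZL, (cap ZL + (t - a0 - w))%N)
  | ZB => if (t < na ZB)%N then (ZB, t) else if (t < b0)%N then (ZM, 0%N)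
          else (ZR, (cap ZR + (t - b0))%N)
  | _ => (z, t)
  end.

Hypothesis naM : na ZM = 1%N.
Hypothesis capM : cap ZM = 0%N.
Hypothesis fullL : (cap ZL <= na ZL)%N.
Hypothesis roomA : (na ZA < cap ZA)%N.
Hypothesis roomB : (na ZB < cap ZB)%N.
(** This is the requirement for M at A, the case with the most free seats in B. *)
Hypothesis fullR : (cap ZR + (cap ZB - na ZB) <= na ZR)%N.
Hypothesis scarce :
  (cap ZL + cap ZA + cap ZB + cap ZR <= na ZL + na ZA + na ZB + na ZR)%N.

Lemma slot_lt z r z' t :
  (r < na z)%N -> slot z r = Some (z', t) -> (t < cap z')%N.
Proof.
move: fullL roomA roomB fullR scarce; rewrite /slot /w /sA /sB /a0 /b0.
move=> hL hA hB hR hS.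
case: z => /= hr.
- case: ltnP => h; first by move=> [<- <-].
 by case: ltnP => // h' [<- <-]; lia.
- by move=> [<- <-]; lia.
- by case: mu => -[<- <-]; lia.
- by move=> [<- <-]; lia.
case: ltnP => h; first by move=> [<- <-].
case: ltnP => h'; first by move=> [<- <-]; lia.
by case: ltnP => // h'' [<- <-]; lia.
Qed.

(** With [slotK] this gives a bijection between seats and served agents, so that every seat is
    taken. *)
Lemma holderK z t : (t < cap z)%N ->
  ((holder z t).2 < na (holder z t).1)%N /\
  slot (holder z t).1 (holder z t).2 = Some (z, t).
Proof.
move: fullL roomA roomB fullR scarce.
rewrite /holder /slot /w /sA /sB /a0 /b0 => hL hA hB hR hS.
case: z => /= ht.
- by rewrite ht; split=> //; apply: leq_trans hL.
- case: (ltnP t (na ZA)) => h1 //=; case: (ltnP t (na ZA + mu)) => h2 /=.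
    rewrite naM; case: mu h2 => /= h2; split=> //; last by exfalso; lia.
    by congr (Some (_, _)); lia.
  set d := (na ZR - cap ZR - (cap ZB - (na ZB + ~~ mu)))%N.
  case: (ltnP (t - (na ZA + mu)) d); rewrite {}/d => h3 /=; (split; first by lia).
    rewrite ifF; last by lia.
    rewrite ifF; last by lia.
    by rewrite ifT; [congr (Some (_, _))|]; lia.
  rewrite ifF; last by lia.
  by rewrite ifT; [congr (Some (_, _))|]; lia.
- by move: ht; rewrite capM.
- case: (ltnP t (na ZB)) => h1 //=; case: (ltnP t (na ZB + ~~ mu)) => h2 /=.
    rewrite naM; case: mu h2 => /= h2; split=> //; first by exfalso; lia.
    by congr (Some (_, _)); lia.
  split; first by lia.
  rewrite ifF; last by lia.
  by rewrite ifT; [congr (Some (_, _))|]; lia.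
- by rewrite ht; split=> //; lia.
Qed.

Lemma slotK z r z' t :
  (r < na z)%N -> slot z r = Some (z', t) -> holder z' t = (z, r).
Proof.
move: fullL roomA roomB fullR scarce.
rewrite /slot /w /sA /sB /a0 /b0 => hL hA hB hR hS.
case: z => /= hr.
- case: ltnP => h; first by move=> [<- <-].
  case: ltnP => // h' [<- <-] /=; rewrite !ifF; try lia.
  by congr (_, _); lia.
- by move=> [<- <-] /=; rewrite hr.
- have -> : r = 0%N by rewrite naM in hr; lia.
  by rewrite /holder /a0 /b0; case: mu => -[<- <-] /=; rewrite ltnn addn1 ltnSn.
- by move=> [<- <-] /=; rewrite hr.
case: ltnP => h; first by move=> [<- <-].
case: ltnP => h' /=.
  by move=> [<- <-] /=; rewrite !ifF; try lia; congr (_, _); lia.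
case: ltnP => // h'' [<- <-] /=; rewrite ifF; last by lia.
rewrite ifF; last by lia.
by rewrite ifT; [congr (_, _)|]; lia.
Qed.

(** Agents of each outer zone take seats from the nearest facilities outwards, so one turned away
    meets only nearer occupants or occupants of her own zone with smaller rank. M is at distance 1
    from both A and B. At A far-right agents (distance 4) rightly precede far-left ones (distance
    5). *)
Lemma slot_stable z r f : (r < na z)%N -> (0 < cap f)%N ->
  (exists z' t, slot z r = Some (z', t) /\ (zdist z z' <= zdist z f)%N) \/
  (forall zl rl t, (rl < na zl)%N -> slot zl rl = Some (f, t) ->
     (zdist zl f < zdist z f)%N \/ zl = z /\ (rl < r)%N).
Proof.
move: fullL roomA roomB fullR scarce.
move=> hL hA hB hR hS hr hf.
case: z hr => hr.
- rewrite {1}/slot -/b0 -/sB -/w -/a0 -/sA.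
  case: (ltnP r (cap ZL)) => h; first by left; exists ZL, r.
  case: f hf => hf.
  + right=> -[] rl t _ //=; last by repeat case: ifP.
      by case: ltnP => [lt _|_]; [right; rewrite (leq_trans lt)|case: ifP].
    by case: mu.
  + case: (ltnP (w + (r - cap ZL)) sA) => h'.
      by left; do 2!eexists; split; first reflexivity.
    right=> -[] rl t _ /=; try by left.
    by case: ltnP => // h2; case: ltnP => // h3 _; right; split=> //; lia.
  + by rewrite capM in hf.
  + by right=> -[] rl t _ //=; repeat case: ifP => // _; left.
  + by right=> -[] rl t _ //=; repeat case: ifP => // _; left.
- by left; exists ZA, r.
- by left; case: f hf => hf; rewrite ?capM // in hf *; rewrite /slot; case: mu;
    do 2!eexists; split; try reflexivity.
- by left; exists ZB, r.
rewrite {1}/slot -/b0 -/sB -/w -/a0 -/sA.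
case: (ltnP r (cap ZR)) => h; first by left; exists ZR, r.
case: f hf => hf.
- case: (ltnP (r - cap ZR) sB) => h'.
    by left; do 2!eexists; split; first reflexivity.
  case: (ltnP (r - cap ZR - sB) sA) => h''.
    by left; do 2!eexists; split; first reflexivity.
  by right=> -[] rl t _ //=; try (by left); repeat case: ifP.
- case: (ltnP (r - cap ZR) sB) => h'.
    by left; do 2!eexists; split; first reflexivity.
  case: (ltnP (r - cap ZR - sB) sA) => h''.
    by left; do 2!eexists; split; first reflexivity.
  right=> -[] rl t hrl /=; try by left.
    by case: ltnP => // h2; case: ltnP => // h3 _; exfalso; lia.
  case: ltnP => // h2; case: ltnP => // h3; case: ltnP => // h4 _.
  by right; split=> //; lia.
- by rewrite capM in hf.
- case: (ltnP (r - cap ZR) sB) => h'.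
    by left; do 2!eexists; split; first reflexivity.
  right=> -[] rl t _ /=; try by left.
    by repeat case: ifP.
  case: ltnP => // h2; case: ltnP => [h3 _|_]; last by case: ifP.
  by right; split=> //; lia.
- right=> -[] rl t _ //=; first by repeat case: ifP.
    by case: mu.
  by case: ltnP => [lt _|_]; [right; rewrite (leq_trans lt)|repeat case: ifP].
Qed.

End ZoneAssignment.

Definition zvalue (R : realType) (o : option (zone * nat)) (z : zone) : R :=
  if o is Some (z', _) then 1 - (zdist z z')%:R / 10 else 0.

(** Sending M to B instead of A raises both [sA] and [w] by one, so the same far-left agents are
    served. The excluded far-right agent is the one who loses the last free seat of B. *)
Lemma slot_toggle (R : realType) (na cap : zone -> nat) z r :
  (na ZA < cap ZA)%N -> (na ZB < cap ZB)%N ->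
  (cap ZR + (cap ZB - na ZB) <= na ZR)%N -> (r < na z)%N ->
  (z, r) <> (ZR, (cap ZR + (cap ZB - na ZB)).-1) ->
  zvalue R (slot na cap true z r) z = zvalue R (slot na cap false z r) z.
Proof.
move=> hA hB hR; case: z => //= hr ne.
- case: ltnP => // h.
  by case: ltnP => h1; case: ltnP => h2 //; exfalso; lia.
- have {}ne : r <> (cap ZR + (cap ZB - na ZB)).-1 by move=> e; rewrite e in ne.
  case: ltnP => // h; case: ltnP => h1.
    by case: ltnP => h2 //; exfalso; lia.
  by case: ltnP => h2; case: ltnP => h3; try (by exfalso; lia);
    case: ltnP => h4 //; exfalso; lia.
Qed.

Lemma zvalue_BA (R : realType) t t' :
  zvalue R (Some (ZB, t)) ZR != zvalue R (Some (ZA, t')) ZR.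
Proof.
rewrite /zvalue (_ : zdist ZR ZB = 2%N) // (_ : zdist ZR ZA = 4%N) //.
by apply/eqP => e; lra.
Qed.

(** * Two equilibria with different welfare in a game laid out by zones *)

Section ZoneGame.
Variables (R : realType) (n m k : nat) (prio : {perm 'I_n}).
Variables (x : 'I_n -> R) (y : 'I_m -> R) (na nf : zone -> nat).
Variables (cl : 'I_n -> zone) (rk : 'I_n -> nat) (ag : zone -> nat -> 'I_n).
Variables (fcl : 'I_m -> zone) (frk : 'I_m -> nat) (fac : zone -> nat -> 'I_m).
Hypothesis k_gt0 : (0 < k)%N.
Hypothesis agents : labelling na cl rk ag.
Hypothesis facilities : labelling nf fcl frk fac.
Hypothesis rk_prio : forall i l, cl i = cl l -> (rk i < rk l)%N -> (prio i < prio l)%N.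
Hypothesis distE : forall i f, `|x i - y f| = (zdist (cl i) (fcl f))%:R / 10.
Hypothesis naM : na ZM = 1%N.
Hypothesis nfM : nf ZM = 0%N.
Hypothesis fullL : (nf ZL * k <= na ZL)%N.
Hypothesis roomA : (na ZA < nf ZA * k)%N.
Hypothesis roomB : (na ZB < nf ZB * k)%N.
Hypothesis fullR : (nf ZR * k + (nf ZB * k - na ZB) <= na ZR)%N.
Hypothesis scarce : (nf ZL * k + nf ZA * k + nf ZB * k + nf ZR * k
   <= na ZL + na ZA + na ZB + na ZR)%N.

Let cap z := (nf z * k)%N.

Let capM : cap ZM = 0%N.
Proof. by rewrite /cap nfM. Qed.

Lemma zone_isNE mu : exists s, isNE k prio x y s /\
  forall i, util k prio x y s i = zvalue R (slot na cap mu (cl i) (rk i)) (cl i).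
Proof.
have [agE agK] := agents; have [facE facK] := facilities.
pose asg i := slot na cap mu (cl i) (rk i).
pose T i := if asg i is Some _ then true else false.
(* The seats of a zone are numbered in blocks of k, one block per facility. The default for unserved
   agents is harmless, since the occupants of every facility beat them. *)
pose s i := if asg i is Some (z, t) then fac z (t %/ k) else fac ZA 0%N.
pose hold f (t : 'I_k) :=
  let: (z, r) := holder na cap mu (fcl f) (frk f * k + t) in ag z r.
have nth_lt f (t : 'I_k) : (frk f * k + t < nf (fcl f) * k)%N.
  have [lt_f _] := facK f; apply: leq_trans (_ : (frk f).+1 * k <= _)%N.
    by rewrite mulSn addnC ltn_add2r.
  by rewrite leq_mul2r lt_f orbT.
have asg_hold f t : asg (hold f t) = Some (fcl f, frk f * k + t)%N.
  have := holderK mu naM capM fullL roomA roomB fullR scarce (nth_lt f t).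
  rewrite /asg /hold; case: holder => z r /= [rz <-].
  by have [-> ->] := agE z r rz.
have s_at i z t : asg i = Some (z, t) ->
    [/\ s i = fac z (t %/ k), fcl (s i) = z & frk (s i) = (t %/ k)%N].
  move=> ai; have [rki _] := agK i.
  have := slot_lt naM capM fullL roomA roomB fullR scarce rki ai.
  rewrite -ltn_divLR // => /facE[].
  by rewrite /s ai.
have dist_s i z t : asg i = Some (z, t) ->
    `|x i - y (s i)| = (zdist (cl i) z)%:R / 10.
  by move=> /s_at[_ fs _]; rewrite distE fs.
have [||||i f|ne u] := @assignment_isNE R n m k prio x y s T hold.
- move=> i f; rewrite distE ler_pdivrMr ?ltr0n // mul1r ler_nat.
  by case: (cl i); case: (fcl f).
- move=> f t t' /(congr1 asg); rewrite !asg_hold => -[/addnI tt].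
  exact: val_inj.
- move=> f t; have := asg_hold f t => ah; split; first by rewrite /T ah.
  have [-> _ _] := s_at _ _ _ ah.
  rewrite divnMDl // divn_small ?ltn_ord // addn0.
  by have [_ ->] := facK f.
- move=> i; rewrite /T; case ai: (asg i) => [[z t]|] // _.
  have [_ fs rs] := s_at _ _ _ ai; have [rki agi] := agK i.
  exists (Ordinal (ltn_pmod t k_gt0)); rewrite /hold fs rs /= -divn_eq.
  by rewrite (slotK naM capM fullL roomA roomB fullR scarce rki ai).
- have [rki _] := agK i; have [rkf _] := facK f.
  have capf : (0 < cap (fcl f))%N by rewrite muln_gt0 k_gt0 (leq_ltn_trans _ rkf).
  have := slot_stable mu naM capM fullL roomA roomB fullR scarce rki capf.
  case=> [[z [t [ai dz]]]|st]; [left|right].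
    split; first by rewrite /T /asg ai.
    by rewrite (dist_s _ _ _ ai) distE ler_pM2r ?invr_gt0 ?ltr0n // ler_nat.
  move=> l; rewrite /T; case al: (asg l) => [[z t]|] // _ sl.
  have [_ fz _] := s_at _ _ _ al; rewrite sl in fz; have [rkl _] := agK l.
  have := st _ _ t rkl; rewrite fz => /(_ al) st'.
  rewrite /beats !distE fz; case: st' => [lt|[cll rkli]].
    by rewrite ltr_pM2r ?invr_gt0 ?ltr0n // ltr_nat lt.
  by rewrite cll eqxx rk_prio ?orbT.
exists s; split=> // i; rewrite u /T /zvalue -/(asg i).
by case ai: (asg i) => [[z t]|] //; rewrite (dist_s _ _ _ ai).
Qed.

Lemma zone_two_welfares : exists s1 s2,
  [/\ isNE k prio x y s1, isNE k prio x y s2 & SW k prio x y s1 != SW k prio x y s2].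
Proof.
have [s1 [ne1 u1]] := zone_isNE true; have [s2 [ne2 u2]] := zone_isNE false.
exists s1, s2; split=> //; have [agE agK] := agents.
(* This agent sits at B if M is at A, and at A otherwise. *)
pose r0 := (nf ZR * k + (nf ZB * k - na ZB)).-1.
have r0_lt : (r0 < na ZR)%N by rewrite /r0; lia.
have [cl0 rk0] := agE ZR r0 r0_lt.
have eq_util i : i != ag ZR r0 -> util k prio x y s1 i = util k prio x y s2 i.
  move=> ne; rewrite u1 u2; have [rki agi] := agK i.
  apply: slot_toggle => //= -[cli rki0]; case/eqP: ne.
  by rewrite -agi cli rki0.
rewrite /SW (bigD1 (ag ZR r0)) // [X in _ != X](bigD1 (ag ZR r0)) //=.
rewrite (eq_bigr (util k prio x y s2) eq_util) (inj_eq (addIr _)) u1 u2 cl0 rk0.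
rewrite /slot ifF; last by rewrite /r0 /cap; lia.
rewrite ifT; last by rewrite /r0 /cap; lia.
rewrite ifF; last by rewrite /r0 /cap; lia.
rewrite ifF; last by rewrite /r0 /cap; lia.
rewrite ifT; last by rewrite /r0 /cap; lia.
exact: zvalue_BA.
Qed.

End ZoneGame.

(** * Realising the zones by reports to a percentile mechanism *)

Definition zone_at (c1 c2 c3 c4 q : nat) : zone :=
  if (q < c1)%N then ZL else if (q < c2)%N then ZA else
  if (q < c3)%N then ZM else if (q < c4)%N then ZB else ZR.

Definition zone_start (c1 c2 c3 c4 : nat) (z : zone) : nat :=
  match z with ZL => 0 | ZA => c1 | ZM => c2 | ZB => c3 | ZR => c4 end.

Definition zone_size (c1 c2 c3 c4 N : nat) (z : zone) : nat :=
  match z with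
  | ZL => c1 | ZA => c2 - c1 | ZM => c3 - c2 | ZB => c4 - c3 | ZR => N - c4
  end.

(** For agents [e] is the priority order, so ranks inside a zone follow priority; for facilities it
    is the identity. [i0] is only the default of [insubd]. *)
Lemma labelling_zone_at N (e : {perm 'I_N}) (i0 : 'I_N) c1 c2 c3 c4 :
  (c1 <= c2)%N -> (c2 <= c3)%N -> (c3 <= c4)%N -> (c4 <= N)%N ->
  labelling (zone_size c1 c2 c3 c4 N) (fun i => zone_at c1 c2 c3 c4 (e i))
    (fun i => (e i - zone_start c1 c2 c3 c4 (zone_at c1 c2 c3 c4 (e i)))%N)
    (fun z r => (e^-1)%g (insubd i0 (zone_start c1 c2 c3 c4 z + r)%N)).
Proof.
move=> h1 h2 h3 h4.
have atE z r : (r < zone_size c1 c2 c3 c4 N z)%N ->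
    (zone_start c1 c2 c3 c4 z + r < N)%N /\
    zone_at c1 c2 c3 c4 (zone_start c1 c2 c3 c4 z + r) = z.
  case: z => /= hr; (split; first by lia); rewrite /zone_at;
    by repeat (case: ltnP => ?; try by exfalso; lia).
split=> [z r /atE[lt at_z]|i]; cbv beta.
  by rewrite permKV val_insubd lt at_z addKn.
have := ltn_ord (e i); set q := nat_of_ord (e i) => ltq.
have [lo hi] : (zone_start c1 c2 c3 c4 (zone_at c1 c2 c3 c4 q) <= q)%N /\
    (q < zone_start c1 c2 c3 c4 (zone_at c1 c2 c3 c4 q) +
         zone_size c1 c2 c3 c4 N (zone_at c1 c2 c3 c4 q))%N.
  by rewrite /zone_at; do 4![case: ltnP => /= ?; first by lia]; lia.
split; first by rewrite ltn_subLR.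
by rewrite subnKC // valKd permK.
Qed.

Lemma zone_at_mono c1 c2 c3 c4 q q' : (q <= q')%N ->
  (place (zone_at c1 c2 c3 c4 q) <= place (zone_at c1 c2 c3 c4 q'))%N.
Proof.
rewrite /zone_at => qq'.
do 4![case: (ltnP q') => [/(leq_ltn_trans qq') ->|_]; first by repeat case: ifP].
by repeat case: ifP.
Qed.

Definition mirror (z : zone) : zone :=
  match z with ZL => ZR | ZA => ZB | ZM => ZM | ZB => ZA | ZR => ZL end.

Lemma mirrorK : involutive mirror.
Proof. by case. Qed.

Lemma labelling_mirror (T : Type) cnt (cl : T -> zone) rk elt :
  labelling cnt cl rk elt ->
  labelling (cnt \o mirror) (mirror \o cl) rk (elt \o mirror).
Proof.
move=> [E K]; split=> [z r /E /= [-> ->]|i /=]; first by rewrite mirrorK.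
by rewrite mirrorK; apply: K.
Qed.

Lemma natr_dist (R : realType) (a b : nat) :
  `|a%:R - b%:R| = ((a - b) + (b - a))%N%:R :> R.
Proof.
case: (leqP a b) => [ab|/ltnW ba].
  rewrite (eqP ab) add0n natrB // ler0_norm ?opprB //.
  by rewrite subr_le0 ler_nat.
by rewrite (eqP ba) addn0 natrB // ger0_norm // subr_ge0 ler_nat.
Qed.

Lemma place_dist (R : realType) z w :
  `|(place z)%:R / 10 - (place w)%:R / 10| = (zdist z w)%:R / 10 :> R.
Proof.
by rewrite -mulrBl normrM natr_dist (@ger0_norm _ 10^-1) // invr_ge0.
Qed.

(** Agents placed along the line in priority order have sorted reports X 0, ..., X (n-1). *)
Lemma PM_monotone (R : realType) (n m : nat) (v : 'I_m -> R)
    (prio : {perm 'I_n}) (X : nat -> R) j :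
  (percentile_rank n v j < n)%N ->
  (forall q q', (q <= q')%N -> X q <= X q') ->
  PM v (fun i => X (prio i)) j = X (percentile_rank n v j).
Proof.
move=> rank_lt X_mono; rewrite /PM -/(percentile_rank n v j).
rewrite (_ : sort _ _ = [seq X q | q <- iota 0 n]).
  by rewrite (nth_map 0%N) ?size_iota // nth_iota.
apply: (sorted_eq (@le_trans _ R) (@le_anti _ R)).
- exact/sort_sorted/le_total.
- apply: (homo_sorted X_mono); exact: iota_sorted.
rewrite perm_sort -val_enum_ord -map_comp.
rewrite [X in perm_eq X _](map_comp (fun i : 'I_n => X i) prio).
apply: perm_map; apply: uniq_perm; rewrite ?enum_uniq //.
  by rewrite map_inj_uniq ?enum_uniq //; apply: perm_inj.
move=> i; rewrite mem_enum inE; apply/mapP; exists ((prio^-1)%g i).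
  by rewrite mem_enum.
by rewrite permKV.
Qed.

Lemma narrow_gap_two_welfares (R : realType) (n m k : nat) (prio : {perm 'I_n})
    (v : 'I_m -> R) (j j' : 'I_m) :
  let p := percentile_rank n v in
  (m * k < n)%N -> (forall f, 0 <= v f <= 1) ->
  (forall f f' : 'I_m, val f' = (val f).+1 -> (p f + 2 <= p f')%N) ->
  val j' = (val j).+1 -> (p j' + 2 <= p j + 2 * k)%N ->
  exists x, in01 x /\ exists s1 s2,
    [/\ isNE k prio x (PM v x) s1, isNE k prio x (PM v x) s2 &
        SW k prio x (PM v x) s1 != SW k prio x (PM v x) s2].
Proof.
move=> p mk_n v01 step jj' narrow.
have n_gt0 : (0 < n)%N by apply: leq_ltn_trans mk_n.
have p_lt f : (p f < n)%N by exact: percentile_rank_lt.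
have p_mono (f f' : 'I_m) : (f <= f')%N -> (p f + (f' - f) * 2 <= p f')%N.
  exact: percentile_rank_gap.
have wide := step _ _ jj'; rewrite /= in jj'.
have k_gt1 : (1 < k)%N by lia.
have j_lt := ltn_ord j; have j'_lt := ltn_ord j'.
(* The facilities before [a] and after [b] are put at the far ends, where the
   agents outside fill them completely. *)
have [a [le_aj fill_a slack_a]] : exists a : 'I_m,
    [/\ (a <= j)%N, (a * k <= p a)%N & (p j + a * k <= p a + j * k)%N].
  have [full|notfull] := leqP (j * k) (p j); first by exists j.
  have m_gt0 : (0 < m)%N by lia.
  by exists (Ordinal m_gt0); split=> //=; lia.
have [b [le_j'b fill_b slack_b]] : exists b : 'I_m,
    [/\ (j' <= b)%N, ((m - b.+1) * k <= n - (p b).+1)%N &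
        (p b + j' * k <= p j' + b * k)%N].
  have [full|notfull] := leqP ((m - j'.+1) * k) (n - (p j').+1).
    by exists j'.
  have m1_lt : (m - 1 < m)%N by lia.
  exists (Ordinal m1_lt); have := p_lt (Ordinal m1_lt); have := p_lt j'.
  split=> /=; [lia|by rewrite (_ : m - (m - 1).+1 = 0)%N //; lia|].
  have -> : ((m - 1) * k = (m - j'.+1) * k + j' * k)%N.
    by rewrite -mulnDl; congr (_ * _)%N; lia.
  lia.
(* The rank of M: the least u above [p j] with [p j'] - u < k, so that B keeps a free seat. The
   narrow gap and k > 1 give u - [p j] < k, so A keeps one too. *)
pose u := maxn (p j).+1 ((p j').+1 - k).
have [lo_u hi_u] : (p j < u)%N /\ (u < p j')%N by rewrite /u; lia.
have pa_j := p_mono a j le_aj; have pj'_b := p_mono j' b le_j'b.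
have := p_lt b; move: (ltn_ord b) => b_lt pb_lt.
pose zone_of := zone_at (p a) u u.+1 (p b).+1.
(* The repeated cut leaves no facility at M. *)
pose fzone f := zone_at a j.+1 j.+1 b.+1 f.
pose na := zone_size (p a) u u.+1 (p b).+1 n.
pose nf := zone_size a j.+1 j.+1 b.+1 m.
(* The agent whose report fixes facility [f] lies in the zone intended for [f]. *)
have zone_rank f : zone_of (p f) = fzone f.
  rewrite /zone_of /fzone /zone_at.
  case: (ltnP f a) => fa.
    by rewrite ifT //; have := p_mono f a; lia.
  rewrite ifF; last by have := p_mono a f fa; lia.
  case: (ltnP f j.+1) => fj.
    by rewrite ifT //; have := p_mono f j; lia.
  rewrite ifF; last by have := p_mono j' f; lia.
  rewrite ifF; last by have := p_mono j' f; lia.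
  case: (ltnP f b.+1) => fb.
    by rewrite ifT //; have := p_mono f b; lia.
  by rewrite ifF //; have := p_mono b f; lia.
have [u1 u2 b1 b2] : [/\ (p a <= u)%N, (u.+1 <= (p b).+1)%N, (a <= j.+1)%N &
    (j.+1 <= b.+1)%N] by split; lia.
have agents := labelling_zone_at prio (Ordinal n_gt0) u1 (leqnSn u) u2 pb_lt.
have facs := labelling_zone_at (1%g : {perm 'I_m}) j b1 (leqnn _) b2 b_lt.
have fzoneE f : zone_at a j.+1 j.+1 b.+1 ((1%g : {perm 'I_m}) f) = fzone f by rewrite perm1.
have rk_prio (c : zone -> zone) : injective c -> forall i l : 'I_n,
    c (zone_of (prio i)) = c (zone_of (prio l)) ->
    (prio i - zone_start (p a) u u.+1 (p b).+1 (zone_of (prio i)) <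
     prio l - zone_start (p a) u u.+1 (p b).+1 (zone_of (prio l)))%N ->
    (prio i < prio l)%N.
  by move=> c_inj i l /c_inj ->; lia.
have roomA : ((u - p a) < (j.+1 - a) * k)%N.
  by rewrite mulnBl mulSn; lia.
have roomB : ((p b).+1 - u.+1 < (b.+1 - j.+1) * k)%N.
  by rewrite mulnBl !mulSn; rewrite jj' mulSn in slack_b; lia.
have total : (a * k + (j.+1 - a) * k + (b.+1 - j.+1) * k + (m - b.+1) * k = m * k)%N.
  by rewrite -!mulnDl; congr (_ * _)%N; lia.
have place01 z : 0 <= ((place z)%:R / 10 : R) <= 1.
  by rewrite divr_ge0 ?ler0n //= ler_pdivrMr ?ltr0n // mul1r ler_nat; case: z.
(* Since [m * k < n], either the far-right agents can fill B or the far-left ones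
   can fill A; the second case is the mirror image of the first. *)
have [surplusR|surplusL] :=
    leqP ((m - b.+1) * k + ((b.+1 - j.+1) * k - ((p b).+1 - u.+1))) (n - (p b).+1).
  pose X q : R := (place (zone_of q))%:R / 10.
  have X_mono q q' : (q <= q')%N -> X q <= X q'.
    by move=> le; rewrite ler_pM2r ?invr_gt0 ?ltr0n // ler_nat zone_at_mono.
  exists (fun i => X (prio i)); split=> [i|]; first exact: place01.
  apply: (zone_two_welfares (ltnW k_gt1) agents facs).
  - exact: (rk_prio id).
  - by move=> i f; rewrite PM_monotone // fzoneE -zone_rank place_dist.
  - by rewrite /= subSnn.
  - by rewrite /= subnn.
  - exact: fill_a.
  - exact: roomA.
  - exact: roomB.
  - exact: surplusR.
  - by rewrite /= total; lia.
(* Mirroring reverses the zones and subtracting from 1 reverses them back, so [X] is still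
   monotone. *)
pose X q : R := 1 - (place (mirror (zone_of q)))%:R / 10.
have X_mono q q' : (q <= q')%N -> X q <= X q'.
  move=> le; rewrite lerB // ler_pM2r ?invr_gt0 ?ltr0n // ler_nat.
  by have := zone_at_mono (p a) u u.+1 (p b).+1 le; rewrite -!/(zone_of _);
    case: (zone_of q); case: (zone_of q').
exists (fun i => X (prio i)); split=> [i|].
  by have := place01 (mirror (zone_of (prio i))); rewrite /X; lra.
apply: (zone_two_welfares (ltnW k_gt1) (labelling_mirror agents) (labelling_mirror facs)).
- exact: (rk_prio mirror (can_inj mirrorK)).
- move=> i f; rewrite PM_monotone // /= fzoneE -zone_rank -place_dist distrC /X.
  by congr `|_|; lra.
- by rewrite /= subSnn.
- by rewrite /= subnn.
- exact: fill_b.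
- exact: roomB.
- exact: roomA.
- by rewrite /=; lia.
- by rewrite /=; lia.
Qed.

(** * From floors to ranks, and the equivalence *)

Lemma floor_percentile (R : realType) (n m : nat) (v : 'I_m -> R) j :
  0 <= v j <= 1 -> Num.floor (v j * (n - 1)%N%:R) = (percentile_rank n v j)%:Z.
Proof.
move=> /andP[v0 _]; rewrite /percentile_rank mulrC truncEfloor.
have : 0 <= Num.floor ((n - 1)%N%:R * v j).
  by rewrite floor_ge0 mulr_ge0 ?ler0n.
by case: Num.floor.
Qed.

Theorem theorem8 (R : realType) (n m k : nat) (prio : {perm 'I_n})
  (v : 'I_m -> R) :
  (2 <= m)%N -> (0 < k)%N -> (m * k < n)%N ->
  (forall j : 'I_m, 0 <= v j <= 1) ->
  (forall j j' : 'I_m, (j < j')%N -> v j < v j') ->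
  (forall j j' : 'I_m, val j' = (val j).+1 ->
     1 < Num.floor (v j' * (n - 1)%N%:R) - Num.floor (v j * (n - 1)%N%:R)) ->
  (equilibrium_stable k prio (@PM R n m v) <->
   (forall j j' : 'I_m, val j' = (val j).+1 ->
     (2 * k%:Z - 1) <= Num.floor (v j' * (n - 1)%N%:R)
                       - Num.floor (v j * (n - 1)%N%:R))).
Proof.
move=> _ k_gt0 mk_n v01 _ step.
have n_gt0 : (0 < n)%N by apply: leq_ltn_trans mk_n.
pose p := percentile_rank n v.
have {}step (j j' : 'I_m) : val j' = (val j).+1 -> (p j + 2 <= p j')%N.
  by move=> /step; rewrite !floor_percentile // -/p; lia.
split=> [[_ stable] j j' jj'|wide].
  rewrite !floor_percentile // -!/(p _).
  have [wide|narrow] := leqP (p j + 2 * k) (p j').+1; first by lia.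
  have [x [x01 [s1 [s2 [ne1 ne2]]]]] : exists x, in01 x /\ exists s1 s2,
      [/\ isNE k prio x (PM v x) s1, isNE k prio x (PM v x) s2 &
          SW k prio x (PM v x) s1 != SW k prio x (PM v x) s2].
    by apply: (@narrow_gap_two_welfares R n m k prio v j j') => //; rewrite -!/(p _); lia.
  by rewrite (stable x x01 s1 s2 ne1 ne2) eqxx.
split; first exact: PM_abs_truthful.
move=> x x01 s1 s2; apply: crowded_SW.
  move=> i j; have := x01 i; have := PM_in01 v01 n_gt0 j x01.
  by rewrite ler_norml; lra.
apply: crowded_PM => // j j' /wide; rewrite !floor_percentile // -!/(p _); lia.
Qed.
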